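(* Let $p$ be a prime and let $k$ be an integer with $2\le k\le p$. Then $$\widehat{\Phi}_k(p)=\max\big\{0,\ 2\lceil p/k\rceil-3\big\}.$$
   Context: For an integer $n\ge 2$, $\mathbb{Z}_n$ denotes the additive cyclic group of integers modulo $n$. For $A\subseteq\mathbb{Z}_n$ the restricted self-sumset is $A\widehat{+}A=\{a+a' : a,a'\in A,\ a\ne a'\}\subseteq\mathbb{Z}_n$ (so it is empty, of size $0$, when $|A|\le 1$). A $k$-coloring of $\mathbb{Z}_n$ is a disjoint union $\mathbb{Z}_n=A_1\sqcup\cdots\sqcup A_k$, with color classes $A_i$. Define $$\widehat{\Phi}_k(n)=\min_{\mathbb{Z}_n=A_1\sqcup\cdots\sqcup A_k}\ \max_{1\le i\le k}|A_i\widehat{+}A_i|,$$ the minimum being over all $k$-colorings of $\mathbb{Z}_n$. *)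

(* Defs.v *)
From HB Require Import structures.
From mathcomp Require Import all_boot all_order all_algebra.

Set Implicit Arguments.
Unset Strict Implicit.
Unset Printing Implicit Defensive.

Import Order.TTheory GRing.Theory Num.Theory.
Local Open Scope ring_scope.

Definition restricted_sumset (n : nat) (A : {set 'Z_n}) : {set 'Z_n} :=
  [set x | [exists a in A, exists a' in A, (a != a') && (x == a + a')]].

(* The classes of a k-coloring are indexed by 'I_k and may be empty. *)
Definition is_coloring (n k : nat) (A : {ffun 'I_k -> {set 'Z_n}}) : bool :=
  [forall i, forall j, (i != j) ==> [disjoint A i & A j]]
  && (\bigcup_(i < k) A i == [set: 'Z_n]).

Definition max_restricted_sumset (n k : nat)
    (A : {ffun 'I_k -> {set 'Z_n}}) : nat :=
  \max_(i < k) #|restricted_sumset (A i)|.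

(* The default value #|'Z_n| of the iterated minimum bounds every term, hence
   is harmless as soon as a coloring exists, i.e. for 0 < k: see Phi_hat_le
   and Phi_hat_attained. As 'Z_n is the ring of integers modulo n only for
   1 < n, this is meaningful only for such n. *)
Definition Phi_hat (k n : nat) : nat :=
  \big[minn/#|'Z_n|]_(A : {ffun 'I_k -> {set 'Z_n}} | is_coloring A)
     max_restricted_sumset A.

Lemma Phi_hat_le (k n : nat) (A : {ffun 'I_k -> {set 'Z_n}}) :
  is_coloring A -> (Phi_hat k n <= max_restricted_sumset A)%N.
Proof. by move=> cA; rewrite /Phi_hat -minEnat -leEnat; exact: bigmin_le_cond. Qed.

Lemma Phi_hat_attained (k n : nat) : (0 < k)%N ->
  exists2 A : {ffun 'I_k -> {set 'Z_n}},
    is_coloring A & Phi_hat k n = max_restricted_sumset A.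
Proof.
case: k => // k _.
pose A0 : {ffun 'I_k.+1 -> {set 'Z_n}} :=
  [ffun i => if i == ord0 then setT else set0].
have cA0 : is_coloring A0.
  apply/andP; split.
    apply/forallP=> i; apply/forallP=> j; apply/implyP; rewrite !ffunE.
    case: (i =P ord0) => [->|_]; case: (j =P ord0) => [->|_] //= _;
      by rewrite -setI_eq0 ?set0I ?setI0.
  by rewrite (bigD1 ord0) //= ffunE eqxx setTU.
have [A cA minA] := arg_minnP (@max_restricted_sumset n k.+1) cA0.
exists A => //; apply/eqP; rewrite eqn_leq Phi_hat_le //=.
rewrite /Phi_hat; elim/big_ind: _ => [|x y lx ly|B cB]; last exact: minA.
  by apply/bigmax_leqP=> i _; apply: max_card.
by rewrite leq_min lx ly.
Qed.

(* Main.v *)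
(* Put m = ceil (p / k). Cutting {0, ..., p-1} into k intervals of length at
   most m gives restricted sumsets of size at most 2m - 3. Conversely some class
   has at least m elements, and the Erdos-Heilbronn bound applies to it. That
   bound follows the polynomial method of Alon, Nathanson and Ruzsa: let A have
   m = n + 2 elements and B be A minus a point. If A ^+ A had at most 2n
   elements, then (x - y) q(x + y), with q monic of degree 2n vanishing on
   A ^+ A, would vanish on A x B, whereas its coefficient at x^(n+1) y^n is, up
   to factors prime to p, (2n)!, which is nonzero modulo p. *)
Require Import Defs.
From HB Require Import structures.
From mathcomp Require Import all_boot all_order all_algebra.
From mathcomp Require Import zify ring.

Set Implicit Arguments.
Unset Strict Implicit.
Unset Printing Implicit Defensive.

Import Order.TTheory GRing.Theory Num.Theory.
Local Open Scope ring_scope.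

(** The last column of the inverse Vandermonde matrix works: pairing with it extracts the
    coefficient of degree [n]. *)
Lemma moment_weights (F : fieldType) (n : nat) (a : 'I_n.+1 -> F) :
  injective a ->
  exists w : 'I_n.+1 -> F,
    forall j, (j <= n)%N -> \sum_i w i * a i ^+ j = (j == n)%:R.
Proof.
move=> inj_a; pose V := Vandermonde n.+1 (\row_j a j).
have unitV : V \in unitmx.
  rewrite unitmxE det_Vandermonde unitfE.
  apply/prodf_neq0 => i _; apply/prodf_neq0 => j lt_ij.
  by rewrite !mxE subr_eq0 (inj_eq inj_a) -val_eqE gtn_eqF.
exists (fun i => (invmx V *m delta_mx ord_max 0 : 'cV_n.+1) i 0) => j le_jn.
have := congr1 (fun u : 'cV_n.+1 => u (Ordinal (le_jn : (j < n.+1)%N)) 0)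
  (mulKVmx unitV (delta_mx ord_max 0)).
rewrite !mxE -val_eqE andbT /= => <-.
by apply: eq_bigr => i _; rewrite !mxE mulrC.
Qed.

(** The Catalan number identity C(2n,n) - C(2n,n+1) = (2n)!/(n!(n+1)!), cleared of division and
    subtraction. *)
Lemma central_bin_fact (n : nat) :
  ('C(2 * n, n) * (n`! * n.+1`!)
     = (2 * n)`! + 'C(2 * n, n.+1) * (n`! * n.+1`!))%N.
Proof.
have := mul_bin_left (2 * n) n.
have := @bin_fact (2 * n) n (leq_addr _ _).
rewrite (_ : 2 * n - n = n)%N; last by lia.
by move=> <-; rewrite factS; nia.
Qed.

(* The weights w, v of the two point sets turn summation over the grid into the
   extraction of the coefficient at x^(n+1) y^n of a polynomial of total degree
   at most 2n + 1, which is how the Nullstellensatz enters. *)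
Lemma monic_root_sums_fact (F : fieldType) (n : nat) (a : 'I_n.+2 -> F)
    (q : {poly F}) :
  injective a -> q \is monic -> size q = (2 * n).+1 ->
  (forall i j, i != j -> root q (a i + a j)) ->
  (2 * n)`!%:R = 0 :> F.
Proof.
move=> inj_a monq szq root_q.
pose b (i : 'I_n.+1) := a (lift ord_max i).
have inj_b : injective b by move=> i j /inj_a /lift_inj.
have [w wE] := moment_weights inj_a; have [v vE] := moment_weights inj_b.
pose mu i := \sum_s w s * a s ^+ i; pose nu j := \sum_t v t * b t ^+ j.
(* For [i > n.+1] the moment [mu i] is not known, but the degree bound then forces [j < n], where
   [nu j] vanishes. *)
have munu i j : (i + j <= (2 * n).+1)%N ->
    mu i * nu j = ((i == n.+1) && (j == n))%:R.
  move=> le_ij; have [le_i|lt_i] := leqP i n.+1.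
    rewrite /mu wE //; case: eqP => [i_n|_]; last by rewrite mul0r.
    by rewrite mul1r /nu vE //; lia.
  have lt_j : (j < n)%N by lia.
  by rewrite [nu j]vE ?(ltnW lt_j) // (ltn_eqF lt_j) andbF mulr0.
pose S k := \sum_s \sum_t w s * v t * ((a s - b t) * (a s + b t) ^+ k).
(* (x - y)(x + y)^k is homogeneous of degree k+1, so only k = 2n reaches the monomial x^(n+1)
   y^n. *)
have SE k : (k <= 2 * n)%N ->
    S k = if k == (2 * n)%N then 'C(2 * n, n)%:R - 'C(2 * n, n.+1)%:R else 0.
  move=> le_k.
  have -> : S k = \sum_(l < k.+1)
      (mu l.+1 * nu (k - l)%N - mu l * nu (k - l).+1) *+ 'C(k, l).
    rewrite /S /mu /nu.
    under [RHS]eq_bigr => l _ do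
      rewrite !big_distrlr /= -sumrB -sumrMnl.
    rewrite [RHS]exchange_big /=; apply: eq_bigr => s _.
    under [RHS]eq_bigr => l _ do rewrite -sumrB -sumrMnl.
    rewrite [RHS]exchange_big /=; apply: eq_bigr => t _.
    rewrite [a s + b t]addrC exprDn !mulr_sumr; apply: eq_bigr => l _.
    by rewrite !exprS -mulr_natr -[RHS]mulr_natr; ring.
  under eq_bigr => l _.
    have lk := ltn_ord l.
    rewrite !munu; [|lia|lia].
    rewrite eqSS mulrnBl -!mulrnA; over.
  have pick m (B : nat -> bool) :
      \sum_(l < k.+1) (((l == m :> nat) && B l) * 'C(k, l))%:R
        = (B m * 'C(k, m))%:R :> F.
    have [lt_mk|le_km] := ltnP m k.+1.
      rewrite (bigD1 (Ordinal lt_mk)) //= eqxx /= big1 ?addr0 // => l.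
      by rewrite -val_eqE /= => /negPf->.
    rewrite (bin_small le_km) muln0 big1 // => l _.
    by rewrite ltn_eqF // (leq_trans (ltn_ord l)).
  rewrite sumrB (pick n (fun l => (k - l)%N == n)).
  rewrite (pick n.+1 (fun l => (k - l).+1 == n)).
  case: ifPn => [/eqP->|ne_k].
    rewrite (_ : 2 * n - n = n)%N ?eqxx ?mul1n; last by lia.
    (* For [n = 0] truncated subtraction makes the index test fail, but ['C(0, 1)] is zero
       anyway. *)
    case: (n) => [|m]; first by rewrite (@bin_small _ 1) ?muln0.
    rewrite (_ : 2 * m.+1 - m.+2 = m)%N; last by lia.
    by rewrite eqxx mul1n.
  case: eqP => [|_]; first by lia.
  have [lt_kn|le_nk] := ltnP k n.+1; first by rewrite (bin_small lt_kn) muln0 subr0.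
  by case: eqP => [|_]; [lia | rewrite subr0].
have S0 : 0 = \sum_(k < size q) q`_k * S k.
  rewrite /S.
  under eq_bigr => k _ do rewrite mulr_sumr.
  rewrite exchange_big big1 //= => s _.
  under eq_bigr => k _ do rewrite mulr_sumr.
  rewrite exchange_big big1 //= => t _.
  transitivity (w s * v t * ((a s - b t) * q.[a s + b t])).
    by rewrite horner_coef !mulr_sumr; apply: eq_bigr => k _; ring.
  (* Where the two points coincide the factor x - y vanishes; elsewhere their sum is a root of
     [q]. *)
  have [->|neq_st] := eqVneq s (lift ord_max t).
    by rewrite -/(b t) subrr mul0r mulr0.
  by have /rootP-> := root_q _ _ neq_st; rewrite !mulr0.
move: S0; rewrite szq big_ord_recr /= SE // eqxx big1 => [|k _]; last first.
  by rewrite SE ?(ltnW (ltn_ord k)) // ltn_eqF ?mulr0.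
have /eqP := monq; rewrite lead_coefE szq /= => ->.
rewrite add0r mul1r => /esym bin_eq.
have /(congr1 (fun x => x%:R : F)) := central_bin_fact n.
rewrite natrD !natrM; move/eqP: bin_eq; rewrite subr_eq0 => /eqP ->.
by move/eqP; rewrite -[X in X == _]add0r (inj_eq (addIr _)) => /eqP.
Qed.

Lemma prime_dvd_fact (p n : nat) : prime p -> (p %| n`!)%N -> (p <= n)%N.
Proof.
move=> p_prime; elim: n => [|n IHn]; first by rewrite Euclid_dvd1.
rewrite factS Euclid_dvdM // => /orP[/dvdn_leq-> // | /IHn]; exact: leqW.
Qed.

(** Stated over ['F_p], that is ['Z_(pdiv p)], to have a field. For m = n+2 the bound on [2 * m]
    says 2n < p, so p does not divide (2n)!. *)
Lemma card_restricted_sumset_Fp (p m : nat) (A : {set 'F_p}) :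
  prime p -> (2 * m <= p + 3)%N -> (m <= #|A|)%N ->
  (2 * m - 3 <= #|@restricted_sumset (pdiv p) A|)%N.
Proof.
move=> p_prime; case: m => [|[|n]] // le_np le_nA.
rewrite leqNgt; apply/negP; set C : {set 'F_p} := restricted_sumset _ => lt_C.
(* The power of ['X] pads the degree to exactly 2n; its extra root is harmless. *)
pose q : {poly 'F_p} := 'X ^+ (2 * n - #|C|) * \prod_(c <- enum C) ('X - c%:P).
have mon_prod : \prod_(c <- enum C) ('X - c%:P) \is monic by exact: monic_prod_XsubC.
have monq : q \is monic by rewrite monicMl ?monicXn.
have szq : size q = (2 * n).+1.
  rewrite size_monicM ?monicXn ?monic_neq0 // size_polyXn size_prod_XsubC.
  by rewrite -cardE; lia.
pose a (i : 'I_n.+2) : 'F_p := nth 0 (enum A) i.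
have lt_a (i : 'I_n.+2) : (i < size (enum A))%N.
  by rewrite -cardE (leq_trans (ltn_ord i)).
have inj_a : injective a.
  move=> i j /eqP; rewrite nth_uniq ?enum_uniq // => /eqP; exact: val_inj.
have root_q (i j : 'I_n.+2) : i != j -> root q (a i + a j).
  move=> ne_ij; have aC : a i + a j \in C.
    rewrite inE; apply/exists_inP; exists (a i).
      by rewrite -mem_enum mem_nth.
    apply/exists_inP; exists (a j); first by rewrite -mem_enum mem_nth.
    by rewrite (inj_eq inj_a) ne_ij eqxx.
  by rewrite rootM root_prod_XsubC mem_enum aC orbT.
have /eqP := monic_root_sums_fact inj_a monq szq root_q.
have p_char : p \in [pchar 'F_p] by exact: pchar_Fp.
rewrite -(dvdn_pcharf p_char) => p_dvd.
have := prime_dvd_fact p_prime p_dvd; lia.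
Qed.

(* The Erdos-Heilbronn bound (Dias da Silva and Hamidoune). *)
Lemma card_restricted_sumset_ge (p m : nat) (A : {set 'Z_p}) :
  prime p -> (2 * m <= p + 3)%N -> (m <= #|A|)%N ->
  (2 * m - 3 <= #|restricted_sumset A|)%N.
Proof.
move=> p_prime le_mp; move: A.
have := fun A => @card_restricted_sumset_Fp p m A p_prime le_mp.
by rewrite (pdiv_id p_prime).
Qed.

(** As integers, the sums lie between 2s+1 and 2s+2m-3; reduction modulo n can only merge them. *)
Lemma restricted_sumset_small (n m : nat) (A : {set 'Z_n}) (s : nat) :
  (forall x : 'Z_n, x \in A -> (s <= x < s + m)%N) ->
  (#|restricted_sumset A| <= 2 * m - 3)%N.
Proof.
move=> A_itv.
apply: (@leq_trans #|[set ((2 * s + 1 + t)%:R : 'Z_n) | t : 'I_(2 * m - 3)]|).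
  apply/subset_leq_card/subsetP => x; rewrite inE.
  case/exists_inP=> a /A_itv a_itv /exists_inP[a' /A_itv a'_itv].
  case/andP; rewrite -val_eqE /= => ne_aa' /eqP->.
  have lt_t : (a + a' - (2 * s + 1) < 2 * m - 3)%N by lia.
  apply/imsetP; exists (Ordinal lt_t) => //=.
  by rewrite subnKC ?natrD ?natr_Zp //; lia.
by rewrite (leq_trans (leq_imset_card _ _)) // card_ord.
Qed.

Lemma interval_coloring (n k m : nat) :
  (1 < n)%N -> (0 < m)%N -> (n <= k * m)%N ->
  is_coloring [ffun i : 'I_k => [set x : 'Z_n | x %/ m == i :> nat]%N].
Proof.
move=> n_gt1 m_gt0 le_n; apply/andP; split.
  apply/forallP=> i; apply/forallP=> j; apply/implyP; rewrite !ffunE => ne_ij.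
  apply/pred0P => x /=; rewrite !inE; apply/negP => /andP[/eqP-> /eqP/val_inj].
  exact/eqP.
apply/eqP/setP=> x; rewrite inE; apply/bigcupP.
have lt_x : (x %/ m < k)%N.
  rewrite ltn_divLR // (leq_trans _ le_n) // -[X in (_ < X)%N](Zp_cast n_gt1).
  exact: ltn_ord.
by exists (Ordinal lt_x); rewrite ?ffunE ?inE.
Qed.

Lemma coloring_large_class (n k m : nat) (A : {ffun 'I_k -> {set 'Z_n}}) :
  (1 < n)%N -> (k * m < n)%N -> is_coloring A -> exists i, (m < #|A i|)%N.
Proof.
move=> n_gt1 lt_n /andP[_ /eqP coverA].
apply/existsP; apply: contraLR lt_n; rewrite negb_exists -leqNgt.
move/forallP=> small; apply: (@leq_trans #|[set: 'Z_n]|).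
  by rewrite cardsT card_ord Zp_cast.
rewrite -coverA (@leq_trans (\sum_(i < k) #|A i|)) //.
  elim/big_rec2: _ => [|i s B _ le_Bs]; first by rewrite cards0.
  by rewrite cardsU (leq_trans (leq_subr _ _)) ?leq_add2l.
rewrite -[X in (X * m)%N]card_ord -sum_nat_const leq_sum // => i _.
by rewrite leqNgt small.
Qed.

(** The hypothesis on [m] encodes ceil(p/k) = m+1 without division. *)
Lemma Phi_hat_prime (p k m : nat) :
  prime p -> (1 < k)%N -> (k * m < p <= k * m.+1)%N ->
  Phi_hat k p = (2 * m.+1 - 3)%N.
Proof.
move=> p_prime k_gt1 /andP[lt_p le_p]; have p_gt1 := prime_gt1 p_prime.
apply/eqP; rewrite eqn_leq; apply/andP; split.
  have colI := interval_coloring p_gt1 (ltn0Sn m) le_p.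
  apply: leq_trans (Phi_hat_le colI) _.
  apply/bigmax_leqP => i _; rewrite ffunE.
  apply: (@restricted_sumset_small _ _ _ (i * m.+1)) => x.
  by rewrite inE => /eqP<-; rewrite leq_divM -mulSnr ltn_ceil.
have [A colA ->] := @Phi_hat_attained k p (ltnW k_gt1).
have [i lt_m] := coloring_large_class p_gt1 lt_p colA.
apply: leq_trans (leq_bigmax i).
(* Since k >= 2, 2m <= km < p, which gives 2(m+1) <= p+3. *)
by apply: card_restricted_sumset_ge => //; nia.
Qed.

Theorem theorem1 (p k : nat) (p_prime : prime p) (k_range : (2 <= k <= p)%N) :
  (Phi_hat k p)%:Z = Num.max 0 (2 * Num.ceil (p%:R / k%:R : rat) - 3).
Proof.
have /andP[k_gt1 le_kp] := k_range; have k_gt0 := ltnW k_gt1.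
pose m := (p.-1 %/ k)%N; have p_gt0 := prime_gt0 p_prime.
have p_itv : (k * m < p <= k * m.+1)%N.
  have := leq_divM p.-1 k; have := ltn_ceil p.-1 k_gt0.
  by rewrite -/m ![(_ * k)%N]mulnC; lia.
rewrite (Phi_hat_prime p_prime k_gt1 p_itv).
(* Truncated subtraction on naturals agrees with the maximum with 0; this matters when m = 0, i.e. k
   = p. *)
rewrite (@ceil_def _ _ m.+1); first by lia.
rewrite (_ : m.+1%:Z - 1 = m); last by lia.
rewrite -!pmulrn ltr_pdivlMr ?ler_pdivrMr ?ltr0n //.
by rewrite -!natrM ltr_nat ler_nat ![(_ * k)%N]mulnC.
Qed.
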